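(* Let $$F(\boldsymbol{x})=\begin{bmatrix}2(x_1-1)^2+(x_2-1)^2+(x_2-2)^2& 3-2x_2\\ 3-2x_2&2(x_1-2)^2+(x_2-1)^2+(x_2-2)^2\end{bmatrix}$$ and $\mathbf{K}=\{(x_1,x_2)\in\mathbb{R}^2: 4-x_1^2\ge0,\ 4-x_2^2\ge0\}$. Then $\inf_{\boldsymbol{x}\in\mathbf{K}}\lambda_{\min}(F(\boldsymbol{x}))=\frac12$, so that for every $\varepsilon>0$ the matrix $F(\boldsymbol{x})-(\frac12-\varepsilon)I_2$ is positive definite for all $\boldsymbol{x}\in\mathbf{K}$. However, for every $\varepsilon\in(0,\frac12)$ there do not exist SOS matrices $S_{i,j}\in\Sigma^2[x_i]$, $i\in\{1,2\}$, $j\in\{0,1\}$, such that $$F(\boldsymbol{x})-\left(\tfrac12-\varepsilon\right)I_2=\sum_{i=1}^2\left(S_{i,0}(x_i)+(4-x_i^2)S_{i,1}(x_i)\right).$$ Consequently, the matrix counterpart (matrix size $p>1$) of Putinar's Positivstellensatz for polynomials with correlative sparsity does not hold in general, even when $p=2$.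
   Context: $\lambda_{\min}$ denotes the smallest eigenvalue and $I_2$ the $2\times2$ identity matrix. $\Sigma^2[x_i]$ denotes the set of $2\times 2$ SOS matrices in the single variable $x_i$, i.e. matrices of the form $R(x_i)^{\intercal}R(x_i)$ with $R\in\mathbb{R}[x_i]^{s\times2}$ for some $s$. The correlative sparsity pattern here consists of the two cliques $\{1\}$ and $\{2\}$ (each monomial of $F$ and each constraint involves only one of the two variables). The scalar ($p=1$) sparse Positivstellensatz asserts that, under the running intersection property of the cliques and an Archimedean condition for each clique, every polynomial respecting the sparsity pattern and positive on $\mathbf{K}$ is a sum over cliques of elements of the quadratic modules in the clique variables. *)

(* Defs.v *)
(* Mathematical Components, with {mpoly R[n]} from multinomials and
   realType / inf from mathcomp-analysis. *)
From mathcomp Require Import all_boot all_order all_algebra.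
From mathcomp Require Import mpoly boolp classical_sets reals.

Set Implicit Arguments.
Unset Strict Implicit.
Unset Printing Implicit Defensive.

Import Order.TTheory GRing.Theory Num.Theory.
Local Open Scope ring_scope.

(* A real symmetric matrix of positive size has a finite nonempty set of
   eigenvalues, so on such matrices this infimum is a minimum. *)
Definition lambda_min (R : realType) (p : nat) (A : 'M[R]_p) : R :=
  inf [set a : R | eigenvalue A a]%classic.

Definition posdef (R : realType) (p : nat) (A : 'M[R]_p) : Prop :=
  A^T = A /\
  forall v : 'cV[R]_p, v != 0 -> 0 < (v^T *m A *m v) ord0 ord0.

Definition evalmx (R : realType) (n p : nat) (M : 'M[{mpoly R[n]}]_p)
    (x : 'rV[R]_n) : 'M[R]_p :=
  map_mx (fun q : {mpoly R[n]} => q.@[x ord0]) M.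

Definition mnm_in (n : nat) (I : {set 'I_n}) (u : 'X_{1..n}) : Prop :=
  forall k : 'I_n, u k != 0%N -> k \in I.

(* q lies in the subring R[x_I] of R[x_1, ..., x_n]. *)
Definition in_vars (R : realType) (n : nat) (I : {set 'I_n})
    (q : {mpoly R[n]}) : Prop :=
  forall u : 'X_{1..n}, u \in msupp q -> mnm_in I u.

(* S = Q^T Q with Q a matrix over R[x_I] with p columns and any number of
   rows; for I = [set i] this is Sigma^p[x_i]. *)
Definition sos_mx (R : realType) (n p : nat) (I : {set 'I_n})
    (S : 'M[{mpoly R[n]}]_p) : Prop :=
  exists (s : nat) (Q : 'M[{mpoly R[n]}]_(s, p)),
    (forall a b, in_vars I (Q a b)) /\ S = Q^T *m Q.

(* The p x p quadratic module in the variables x_I generated by the g_j with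
   j in J; p = 1 gives the usual scalar quadratic module. *)
Definition quad_module (R : realType) (n m p : nat) (I : {set 'I_n})
    (J : {set 'I_m}) (g : 'I_m -> {mpoly R[n]})
    (M : 'M[{mpoly R[n]}]_p) : Prop :=
  exists (S0 : 'M[{mpoly R[n]}]_p) (S : 'I_m -> 'M[{mpoly R[n]}]_p),
    [/\ sos_mx I S0,
        forall j, j \in J -> sos_mx I (S j)
      & M = S0 + \sum_(j in J) g j *: S j].

Definition archimedean_on (R : realType) (n m : nat) (I : {set 'I_n})
    (J : {set 'I_m}) (g : 'I_m -> {mpoly R[n]}) : Prop :=
  exists N : R,
    quad_module I J g ((N%:MP - \sum_(k in I) 'X_k ^+ 2)%:M : 'M_1).

(* Cliques are listed in the order I_0, ..., I_(t-1). *)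
Definition running_intersection (n t : nat) (I : 'I_t -> {set 'I_n}) : Prop :=
  forall l : 'I_t, (0 < l)%N ->
    exists2 s : 'I_t, (s < l)%N &
      I l :&: (\bigcup_(k < t | (k < l)%N) I k) \subset I s.

(* Every monomial of every entry of F only involves variables of one clique. *)
Definition respects_pattern (R : realType) (n p t : nat)
    (I : 'I_t -> {set 'I_n}) (F : 'M[{mpoly R[n]}]_p) : Prop :=
  forall (a b : 'I_p) (u : 'X_{1..n}),
    u \in msupp (F a b) -> exists l : 'I_t, mnm_in (I l) u.

(* The p x p matrix version of Putinar's Positivstellensatz with correlative
   sparsity (p = 1 being the scalar sparse Positivstellensatz). The function c
   assigns each constraint g_j to a clique containing its variables, so that
   the fibres of c partition the constraints. *)
Definition sparse_putinar (R : realType) (p : nat) : Prop :=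
  forall (n m t : nat) (I : 'I_t -> {set 'I_n}) (c : 'I_m -> 'I_t)
      (g : 'I_m -> {mpoly R[n]}) (F : 'M[{mpoly R[n]}]_p),
    \bigcup_(l < t) I l = [set: 'I_n] ->
    running_intersection I ->
    (forall j : 'I_m, in_vars (I (c j)) (g j)) ->
    (forall l : 'I_t, archimedean_on (I l) [set j | c j == l] g) ->
    F^T = F ->
    respects_pattern I F ->
    (forall x : 'rV[R]_n,
       (forall j : 'I_m, 0 <= (g j).@[x ord0]) -> posdef (evalmx F x)) ->
    exists G : 'I_t -> 'M[{mpoly R[n]}]_p,
      (forall l : 'I_t, quad_module (I l) [set j | c j == l] g (G l)) /\
      F = \sum_(l < t) G l.

(* The variables x_1, x_2 are 'X_0, 'X_1. *)
Definition exF (R : realType) : 'M[{mpoly R[2]}]_2 :=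
  let x1 : {mpoly R[2]} := 'X_(0 : 'I_2) in
  let x2 : {mpoly R[2]} := 'X_(1 : 'I_2) in
  \matrix_(i, j)
    if i == j then
      if i == 0 then 2 * (x1 - 1) ^+ 2 + (x2 - 1) ^+ 2 + (x2 - 2) ^+ 2
      else 2 * (x1 - 2) ^+ 2 + (x2 - 1) ^+ 2 + (x2 - 2) ^+ 2
    else 3 - 2 * x2.

Definition exK (R : realType) : set 'rV[R]_2 :=
  [set x : 'rV[R]_2 | 0 <= 4 - x 0 0 ^+ 2 /\ 0 <= 4 - x 0 1 ^+ 2]%classic.

Arguments exF R : clear implicits.
Arguments exK R : clear implicits.

(* Main.v *)
(* With s = 2 x_1 - 3, t = 3 - 2 x_2 and N = p^2 + q^2, the quadratic form f of
   F - I/2 at (p, q) satisfies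
     2 N f = (s N + p^2 - q^2)^2 + (t N + 2 p q)^2,
   so 1/2 bounds the spectrum from below; it is attained at (1, 3/2).
   If F - lam I = A(x_1) + B(x_2) with A and B positive semidefinite on
   [-2, 2], then adding the form of B(1) at (1, -1) to that of B(2) at (1, 1)
   cancels the off-diagonal entries of A, and leaves
     -4 lam - 2 A(1)_11 - 2 A(2)_22 >= 0,
   which is absurd for lam > 0. Membership in the quadratic
   modules enters only through positivity on [-2, 2] and dependence on a single
   variable. *)
Require Import Defs.
From mathcomp Require Import all_boot all_order all_algebra.
From mathcomp Require Import mpoly boolp classical_sets reals.
From mathcomp Require Import ring lra.

Set Implicit Arguments.
Unset Strict Implicit.
Unset Printing Implicit Defensive.

Import Order.TTheory GRing.Theory Num.Theory.
Local Open Scope ring_scope.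

(** * Positive semidefinite quadratic forms *)

Definition psd (R : realType) (p : nat) (A : 'M[R]_p) : Prop :=
  forall v : 'cV[R]_p, 0 <= (v^T *m A *m v) ord0 ord0.

Lemma psdD (R : realType) (p : nat) (A B : 'M[R]_p) :
  psd A -> psd B -> psd (A + B).
Proof. by move=> hA hB v; rewrite mulmxDr mulmxDl mxE addr_ge0. Qed.

Lemma psdZ (R : realType) (p : nat) (c : R) (A : 'M[R]_p) :
  0 <= c -> psd A -> psd (c *: A).
Proof. by move=> hc hA v; rewrite -scalemxAr -scalemxAl mxE mulr_ge0. Qed.

Lemma psd_gram (R : realType) (s p : nat) (Q : 'M[R]_(s, p)) : psd (Q^T *m Q).
Proof.
move=> v; rewrite mulmxA -trmx_mul -mulmxA mxE sumr_ge0 // => k _.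
by rewrite mxE sqr_ge0.
Qed.

Lemma psd_sum (R : realType) (p m : nat) (J : {set 'I_m})
    (A : 'I_m -> 'M[R]_p) :
  (forall j, j \in J -> psd (A j)) -> psd (\sum_(j in J) A j).
Proof.
move=> hA; apply: (big_ind (@psd R p)) => //; last exact: psdD.
by move=> v; rewrite mulmx0 mul0mx mxE.
Qed.

(** * Pointwise values of SOS matrices and quadratic modules *)

Section Evaluation.
Variables (R : realType) (n : nat).
Implicit Types (x y : 'rV[R]_n).

Lemma evalmxE x p (M : 'M[{mpoly R[n]}]_p) :
  evalmx M x = map_mx (meval (x ord0)) M.
Proof. by []. Qed.

Lemma evalmxD x p (A B : 'M[{mpoly R[n]}]_p) :
  evalmx (A + B) x = evalmx A x + evalmx B x.
Proof. by rewrite !evalmxE map_mxD. Qed.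

Lemma evalmxZ x p (q : {mpoly R[n]}) (A : 'M[{mpoly R[n]}]_p) :
  evalmx (q *: A) x = q.@[x ord0] *: evalmx A x.
Proof. by rewrite !evalmxE map_mxZ. Qed.

Lemma evalmx_sum x p m (J : {set 'I_m}) (A : 'I_m -> 'M[{mpoly R[n]}]_p) :
  evalmx (\sum_(j in J) A j) x = \sum_(j in J) evalmx (A j) x.
Proof. by rewrite evalmxE raddf_sum. Qed.

(** Outside [I] all exponents vanish, so those coordinates only contribute factors [x ^+ 0 = 1]. *)
Lemma meval_in_vars (I : {set 'I_n}) (q : {mpoly R[n]}) x y :
  in_vars I q -> {in I, x ord0 =1 y ord0} -> q.@[x ord0] = q.@[y ord0].
Proof.
move=> hq hxy; rewrite !mevalE; apply: eq_big_seq => u /hq hu; congr (_ * _).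
apply: eq_bigr => k _; have [->|uk] := eqVneq (u k) 0%N; first by rewrite !expr0.
by rewrite hxy // hu.
Qed.

Lemma psd_sos_mx (I : {set 'I_n}) p (S : 'M[{mpoly R[n]}]_p) x :
  sos_mx I S -> psd (evalmx S x).
Proof.
by case=> s [Q [_ ->]]; rewrite evalmxE map_mxM -map_trmx; apply: psd_gram.
Qed.

Lemma evalmx_sos_mx (I : {set 'I_n}) p (S : 'M[{mpoly R[n]}]_p) x y :
  sos_mx I S -> {in I, x ord0 =1 y ord0} -> evalmx S x = evalmx S y.
Proof.
case=> s [Q [hQ ->]] hxy; rewrite !evalmxE !map_mxM -!map_trmx.
suff -> : map_mx (meval (x ord0)) Q = map_mx (meval (y ord0)) Q by [].
by apply/matrixP => a b; rewrite !mxE; apply: meval_in_vars (hQ a b) hxy.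
Qed.

Variables (m p : nat) (I : {set 'I_n}) (J : {set 'I_m}).
Variables (g : 'I_m -> {mpoly R[n]}) (M : 'M[{mpoly R[n]}]_p).

(** The easy half of a Positivstellensatz: Gram matrices are positive semidefinite at every point,
    and nonnegative weights preserve this. *)
Lemma psd_quad_module x :
  quad_module I J g M -> (forall j, j \in J -> 0 <= (g j).@[x ord0]) ->
  psd (evalmx M x).
Proof.
case=> S0 [S [hS0 hS ->]] hg; rewrite evalmxD evalmx_sum.
apply: psdD; first exact: psd_sos_mx hS0.
apply: psd_sum => j jJ; rewrite evalmxZ.
by apply: psdZ; [exact: hg | exact: psd_sos_mx (hS j jJ)].
Qed.

Lemma evalmx_quad_module x y :
  quad_module I J g M -> (forall j, j \in J -> in_vars I (g j)) ->
  {in I, x ord0 =1 y ord0} -> evalmx M x = evalmx M y.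
Proof.
case=> S0 [S [hS0 hS ->]] hg hxy; rewrite !evalmxD !evalmx_sum.
rewrite (evalmx_sos_mx hS0 hxy); congr (_ + _); apply: eq_bigr => j jJ.
by rewrite !evalmxZ (meval_in_vars (hg j jJ) hxy) (evalmx_sos_mx (hS j jJ) hxy).
Qed.

End Evaluation.

(** * Quadratic forms and eigenvalues of 2 x 2 matrices *)

Lemma big_ord2 (V : nmodType) (f : 'I_2 -> V) : \sum_(i < 2) f i = f 0 + f 1.
Proof.
by rewrite big_ord_recl big_ord1; congr (_ + f _); apply/val_inj.
Qed.

Lemma forall_ord2 (P : 'I_2 -> Prop) : P 0 -> P 1 -> forall i, P i.
Proof.
by move=> P0 P1 [[|[|//]] hi]; [move: P0|move: P1]; congr P; apply/val_inj.
Qed.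

Lemma quad_form2 (R : realType) (A : 'M[R]_2) (v : 'cV[R]_2) :
  (v^T *m A *m v) ord0 ord0 =
  v 0 0 ^+ 2 * A 0 0 + v 0 0 * v 1 0 * (A 0 1 + A 1 0) + v 1 0 ^+ 2 * A 1 1.
Proof.
by rewrite mxE big_ord2 !mxE !big_ord2 !mxE; ring.
Qed.

(** A diagonal matrix has the first basis vector as eigenvector; otherwise the quadratic formula
    gives a real root of the characteristic polynomial. *)
Lemma eigenvalue2_exists (R : realType) (A : 'M[R]_2) :
  A^T = A -> exists a, eigenvalue A a.
Proof.
move=> sA; have A10 : A 1 0 = A 0 1 by rewrite -{1}sA mxE.
have [b0|b0] := eqVneq (A 0 1) 0.
  exists (A 0 0); apply/eigenvalueP; exists (delta_mx 0 0).
    apply/matrixP => i; rewrite ord1; apply: forall_ord2;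
    by rewrite !mxE big_ord2 !mxE /= ?A10 ?b0; ring.
  by apply/eqP => /matrixP /(_ 0 0); rewrite !mxE /=; apply/eqP/oner_neq0.
(* [D] is the discriminant of the characteristic polynomial, a sum of squares by symmetry; [l] below
   is its larger root. *)
pose D := (A 0 0 - A 1 1) ^+ 2 + 4 * A 0 1 ^+ 2.
have hD : Num.sqrt D ^+ 2 = D.
  by rewrite sqr_sqrtr // addr_ge0 ?sqr_ge0 // mulr_ge0 ?sqr_ge0.
pose l := (A 0 0 + A 1 1 + Num.sqrt D) / 2.
have hl : (l - A 0 0) * (l - A 1 1) = A 0 1 ^+ 2.
  apply: (@mulfI _ 4); first by rewrite pnatr_eq0.
  transitivity (Num.sqrt D ^+ 2 - (A 0 0 - A 1 1) ^+ 2).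
    by rewrite /l; field.
  by rewrite hD /D; ring.
exists l; apply/eigenvalueP.
(* The first eigenvector equation is an identity and the second is [hl]; the row is nonzero because
   [A 0 1] is. *)
exists (\row_j (if j == 0 then A 0 1 else l - A 0 0)).
  apply/matrixP => i; rewrite ord1; apply: forall_ord2;
    rewrite !mxE big_ord2 !mxE /= ?A10; first by ring.
  by rewrite -expr2 -hl; ring.
by apply/eqP => /matrixP /(_ 0 0); rewrite !mxE /=; apply/eqP.
Qed.

(* The infimum in [lambda_min] is [0] on an empty spectrum, whence the
   symmetry hypothesis. *)
Lemma le_lambda_min2 (R : realType) (A : 'M[R]_2) (c : R) :
  A^T = A -> psd (A - c%:M) ->
  lbound [set a | eigenvalue A a]%classic c /\ c <= lambda_min A.
Proof.
move=> sA hA.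
have lb : lbound [set a | eigenvalue A a]%classic c.
  (* Eigenvectors are rows here, so the form is tested at [v^T], where it equals [a - c] times the
     squared norm of [v]. *)
  move=> a /eigenvalueP [v vA v0]; have := hA v^T.
  rewrite trmxK mulmxBr vA mul_mx_scalar -scalerBl -scalemxAl mxE.
  suff vv : 0 < (v *m v^T) ord0 ord0 by rewrite pmulr_lge0 // subr_ge0.
  rewrite lt_neqAle mxE sumr_ge0 ?andbT => [|k _]; last by rewrite mxE sqr_ge0.
  apply: contra v0; rewrite eq_sym psumr_eq0 => [/allP h|k _];
    last by rewrite mxE sqr_ge0.
  apply/eqP/matrixP => i k; rewrite ord1 mxE; have := h k (mem_index_enum _).
  by rewrite mxE -expr2 sqrf_eq0 => /eqP.
by split=> //; apply: lb_le_inf lb; case: (eigenvalue2_exists sA) => a; exists a.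
Qed.

(** At numerical [p] and [q] this is a linear inequality in the entries, in the reach of [lra]. *)
Lemma psd2_ge0 (R : realType) (A : 'M[R]_2) (p q : R) :
  psd A -> 0 <= p ^+ 2 * A 0 0 + p * q * (A 0 1 + A 1 0) + q ^+ 2 * A 1 1.
Proof.
by move=> /(_ (\col_i (if i == 0 then p else q))); rewrite quad_form2 !mxE.
Qed.

(** * Closure properties of the polynomials in the variables of a clique *)

Section InVars.
Variables (R : realType) (n : nat) (I : {set 'I_n}).
Implicit Types p q : {mpoly R[n]}.

Lemma in_varsC c : in_vars I (c%:MP : {mpoly R[n]}).
Proof.
move=> u; rewrite msuppC; case: eqP => // _; rewrite inE => /eqP -> k.
by rewrite mnm0E.
Qed.

Lemma in_varsX k : k \in I -> in_vars I ('X_k : {mpoly R[n]}).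
Proof.
move=> kI u; rewrite msuppX inE => /eqP -> l; rewrite mnm1E.
by have [<-|] := eqVneq k l.
Qed.

Lemma in_varsD p q : in_vars I p -> in_vars I q -> in_vars I (p + q).
Proof.
by move=> hp hq u /msuppD_le; rewrite mem_cat => /orP[/hp|/hq].
Qed.

Lemma in_varsB p q : in_vars I p -> in_vars I q -> in_vars I (p - q).
Proof.
by move=> hp hq u /msuppB_le; rewrite mem_cat => /orP[/hp|/hq].
Qed.

Lemma in_varsM p q : in_vars I p -> in_vars I q -> in_vars I (p * q).
Proof.
move=> hp hq u /msuppM_le /allpairsP[[m1 m2] /= [/hp h1 /hq h2 ->]] k.
by rewrite mnmDE addn_eq0 negb_and => /orP[/h1|/h2].
Qed.

Lemma in_vars_nat k : in_vars I (k%:R : {mpoly R[n]}).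
Proof. by rewrite -[k%:R]mpolyC_nat; apply: in_varsC. Qed.

Lemma in_vars_sqr p : in_vars I p -> in_vars I (p ^+ 2).
Proof. by move=> hp; rewrite expr2; apply: in_varsM. Qed.

End InVars.

(** * The spectrum of the example *)

Section Example.
Variable R : realType.
Implicit Types (x : 'rV[R]_2) (v : 'cV[R]_2).

Lemma evalmx_exF x : evalmx (exF R) x =
  \matrix_(i, j)
    if i == j then
      2 * (x 0 0 - (if i == 0 then 1 else 2)) ^+ 2 + (x 0 1 - 1) ^+ 2
        + (x 0 1 - 2) ^+ 2
    else 3 - 2 * x 0 1.
Proof.
apply/matrixP => i j; rewrite !mxE; case: eqP => _; first case: eqP => _;
  by rewrite ?(mevalB, mevalD, mevalM, mevalXU, rmorphXn, rmorph_nat, meval1) /=.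
Qed.

Lemma exF_sym : (exF R)^T = exF R.
Proof.
by apply/matrixP => i j; rewrite !mxE eq_sym; case: eqP => // ->.
Qed.

Lemma evalmx_exF_sym x : (evalmx (exF R) x)^T = evalmx (exF R) x.
Proof. by rewrite !evalmxE map_trmx exF_sym. Qed.

Lemma psd_exF x : psd (evalmx (exF R) x - (1 / 2)%:M).
Proof.
move=> v; rewrite quad_form2 evalmx_exF !mxE /=.
move: (x 0 0) (x 0 1) (v 0 0) (v 1 0) => a b p q; set f := (X in 0 <= X).
(* The sum-of-squares identity bounds a multiple of [f] by the squared norm, which must be nonzero
   to be cancelled. *)
have [pq0|pq0] := eqVneq (p ^+ 2 + q ^+ 2) 0.
  move/eqP: pq0; rewrite paddr_eq0 ?sqr_ge0 // !sqrf_eq0 => /andP[/eqP p0 /eqP q0].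
  by rewrite /f p0 q0 !expr0n /= !mul0r !addr0.
have pq : 0 < p ^+ 2 + q ^+ 2 by rewrite lt_neqAle eq_sym pq0 addr_ge0 ?sqr_ge0.
rewrite -(pmulr_rge0 _ pq) -(pmulr_rge0 _ (ltr0n R 2)).
suff -> : 2%:R * ((p ^+ 2 + q ^+ 2) * f) =
    ((2 * a - 3) * (p ^+ 2 + q ^+ 2) + (p ^+ 2 - q ^+ 2)) ^+ 2
    + ((3 - 2 * b) * (p ^+ 2 + q ^+ 2) + 2 * p * q) ^+ 2.
  by rewrite addr_ge0 ?sqr_ge0.
by rewrite /f; field.
Qed.

Lemma posdef_exF (eps : R) x :
  0 < eps -> posdef (evalmx (exF R) x - (1 / 2 - eps)%:M).
Proof.
move=> eps0; split; first by rewrite linearB /= evalmx_exF_sym tr_scalar_mx.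
move=> v v0; have := psd_exF x v; rewrite !quad_form2 !mxE /=.
(* Lowering the shift by [eps] adds [eps] times the squared norm of [v] to a nonnegative form. *)
have : 0 < eps * (v 0 0 ^+ 2 + v 1 0 ^+ 2); last by lra.
rewrite mulr_gt0 // lt_neqAle addr_ge0 ?sqr_ge0 // andbT eq_sym.
apply: contra v0; rewrite paddr_eq0 ?sqr_ge0 // !sqrf_eq0 => /andP[/eqP p0 /eqP q0].
apply/eqP/matrixP; apply: forall_ord2 => j; rewrite ord1 mxE //.
Qed.

Definition pt (a b : R) : 'rV[R]_2 := \row_j (if j == 0 then a else b).

Lemma inf_lambda_min_exF :
  inf [set lambda_min (evalmx (exF R) x) | x in exK R]%classic = 1 / 2.
Proof.
have hx x := le_lambda_min2 (evalmx_exF_sym x) (psd_exF x).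
have lb :
    lbound [set lambda_min (evalmx (exF R) x) | x in exK R]%classic (1 / 2).
  by move=> _ [x _ <-]; case: (hx x).
(* At this point the matrix is diagonal with entries 1/2 and 5/2. *)
have K0 : exK R (pt 1 (3 / 2)) by rewrite /exK /= !mxE /=; split; lra.
apply/eqP; rewrite eq_le; apply/andP; split; last first.
  apply: lb_le_inf lb.
  by exists (lambda_min (evalmx (exF R) (pt 1 (3 / 2)))), (pt 1 (3 / 2)).
apply: (@le_trans _ _ (lambda_min (evalmx (exF R) (pt 1 (3 / 2))))).
  by apply: ge_inf; [exists (1 / 2) | exists (pt 1 (3 / 2))].
apply: ge_inf; first by exists (1 / 2); case: (hx (pt 1 (3 / 2))).
apply/eigenvalueP; exists (delta_mx 0 0); last first.
  by apply/eqP => /matrixP /(_ 0 0); rewrite !mxE /=; apply/eqP/oner_neq0.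
rewrite evalmx_exF; apply/matrixP => i; rewrite ord1; apply: forall_ord2;
  by rewrite !mxE big_ord2 !mxE /=; field.
Qed.

(** * Impossibility of the decomposition *)

Definition box_constraint (j : 'I_2) : {mpoly R[2]} := 4 - 'X_j ^+ 2.

Lemma in_vars_box (j : 'I_2) : in_vars [set j] (box_constraint j).
Proof.
by apply: in_varsB; [apply: in_vars_nat | apply/in_vars_sqr/in_varsX; rewrite inE].
Qed.

Lemma meval_box (j : 'I_2) x : (box_constraint j).@[x ord0] = 4 - x 0 j ^+ 2.
Proof. by rewrite mevalB rmorph_nat rmorphXn /= mevalXU. Qed.

Lemma exF_not_split (lam : R) (G : 'I_2 -> 'M[{mpoly R[2]}]_2) :
  0 < lam ->
  (forall l, quad_module [set l] [set l] box_constraint (G l)) ->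
  exF R - (lam%:MP)%:M <> \sum_(l < 2) G l.
Proof.
move=> lam0 hG; rewrite big_ord2 => eqF.
have ind l (x y : 'rV[R]_2) : x 0 l = y 0 l -> evalmx (G l) x = evalmx (G l) y.
  move=> xy; apply: evalmx_quad_module (hG l) _ _ => j; rewrite inE => /eqP -> //.
  exact: in_vars_box.
have pos l x : 0 <= 4 - x 0 l ^+ 2 -> psd (evalmx (G l) x).
  move=> hx; apply: psd_quad_module (hG l) _ => j.
  by rewrite inE => /eqP ->; rewrite meval_box.
(* The coordinate set to 0 is a dummy: by [ind], each summand depends on its own variable only. *)
pose A a := evalmx (G 0) (pt a 0); pose B b := evalmx (G 1) (pt 0 b).
have eqAB a b : evalmx (exF R) (pt a b) - lam%:M = A a + B b.
  have -> : A a = evalmx (G 0) (pt a b) by apply: ind; rewrite !mxE.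
  have -> : B b = evalmx (G 1) (pt a b) by apply: ind; rewrite !mxE.
  by rewrite -evalmxD -eqF !evalmxE map_mxB map_scalar_mx /= mevalC.
have A1 : psd (A 1) by apply: pos; rewrite !mxE /=; lra.
have A2 : psd (A 2) by apply: pos; rewrite !mxE /=; lra.
have B1 : psd (B 1) by apply: pos; rewrite !mxE /=; lra.
have B2 : psd (B 2) by apply: pos; rewrite !mxE /=; lra.
clearbody A B; have entry i j a b := congr1 (fun M : 'M_2 => M i j) (eqAB a b).
have := psd2_ge0 1 0 A1; have := psd2_ge0 0 1 A2.
have := psd2_ge0 1 (-1) B1; have := psd2_ge0 1 1 B2.
(* At these points the chosen diagonal entry of [exF] is always 1. *)
have := entry 0 0 1 1; have := entry 0 0 1 2; have := entry 1 1 2 1; have := entry 1 1 2 2.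
(* The off-diagonal entries of [exF] are 1 at [b = 1] and -1 at [b = 2]; reading both at the same
   [a = 0] lets the entries of [A 0] cancel. *)
have := entry 0 1 0 1; have := entry 0 1 0 2; have := entry 1 0 0 1; have := entry 1 0 0 2.
rewrite !evalmx_exF !mxE /=; lra.
Qed.

(** * Failure of the sparse Positivstellensatz for matrices of size 2 *)

Lemma sos_mx0 n p (I : {set 'I_n}) : sos_mx I (0 : 'M[{mpoly R[n]}]_p).
Proof.
by exists 0%N, 0; split=> [[]//|]; rewrite mulmx0.
Qed.

Lemma sos_mx1 n p (I : {set 'I_n}) : sos_mx I (1%:M : 'M[{mpoly R[n]}]_p).
Proof.
exists p, 1%:M; split=> [a b|]; last by rewrite trmx1 mulmx1.
by rewrite mxE; apply: in_vars_nat.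
Qed.

Lemma sparse_putinar2_false : ~ sparse_putinar R 2.
Proof.
have fibre (l : 'I_2) : [set j : 'I_2 | id j == l] = [set l].
  by apply/setP => j; rewrite !inE.
(* The shift 1/4 is below 1/2, giving positive definiteness, and above 0, excluding a splitting. *)
move=> /(_ 2 2 2 (fun l => [set l]) id box_constraint (exF R - ((1 / 4)%:MP)%:M)).
case.
- by apply/setP => j; rewrite inE; apply/finset.bigcupP; exists j; rewrite ?inE.
(* The cliques are disjoint singletons, so the intersection is empty. *)
- move=> l l0; exists 0 => //; apply/fintype.subsetP => j.
  rewrite !inE => /andP[/eqP -> {j}].
  by case/finset.bigcupP => k kl; rewrite inE => /eqP lk; rewrite lk ltnn in kl.
- exact: in_vars_box.
(* With bound 4, the Archimedean certificate is the constraint itself with multiplier 1. *)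
- move=> l; exists 4; exists 0, (fun=> 1%:M); split.
  + exact: sos_mx0.
  + by move=> j _; apply: sos_mx1.
  + by rewrite fibre !big_set1 add0r /box_constraint scalemx1 mpolyC_nat.
- by rewrite linearB /= exF_sym tr_scalar_mx.
(* Each entry is a polynomial in the first variable plus one in the second, so each of its monomials
   lies in one clique. *)
- have split_entry (a b : 'I_2) : exists q0 q1 : {mpoly R[2]},
      [/\ (exF R - ((1 / 4)%:MP)%:M) a b = q0 + q1,
         in_vars [set 0] q0 & in_vars [set 1] q1].
    have X i : in_vars [set i] ('X_i : {mpoly R[2]}).
      by apply: in_varsX; rewrite inE.
    pose c : {mpoly R[2]} := if a == 0 then 1 else 2.
    have hc I : in_vars I c.
      by rewrite /c; case: eqP => _; [exact: (@in_vars_nat _ _ _ 1)|exact: in_vars_nat].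
    exists (if a == b then 2 * ('X_0 - c) ^+ 2 - (1 / 4)%:MP else 0),
      (if a == b then ('X_1 - 1) ^+ 2 + ('X_1 - 2) ^+ 2 else 3 - 2 * 'X_1).
    split.
    + rewrite !mxE /c; case: eqP => _; last by rewrite mulr0n subr0 add0r.
      by rewrite mulr1n; case: eqP => _; ring.
    + case: eqP => _; last exact: (@in_vars_nat _ _ _ 0).
      apply: in_varsB; last exact: in_varsC.
      by apply: in_varsM; [apply: in_vars_nat | apply/in_vars_sqr/in_varsB].
    + have X1 k : in_vars [set 1] ('X_1 - k%:R : {mpoly R[2]}).
        by apply: in_varsB; [apply: X | apply: in_vars_nat].
      case: eqP => _.
        by apply: in_varsD; apply: in_vars_sqr; [exact: (X1 1) | exact: X1].
      by apply: in_varsB; [|apply: in_varsM; last exact: X]; apply: in_vars_nat.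
  move=> a b u; have [q0 [q1 [-> h0 h1]]] := split_entry a b.
  by move=> /msuppD_le; rewrite mem_cat => /orP[/h0|/h1]; [exists 0 | exists 1].
- move=> x _; have := @posdef_exF (1 / 4) x.
  rewrite !evalmxE map_mxB map_scalar_mx /= mevalC.
  have -> : 1 / 2 - 1 / 4 = 1 / 4 :> R by field.
  by apply; lra.
- move=> G [hG eqF]; apply: (@exF_not_split (1 / 4) G _ _ eqF); first by lra.
  by move=> l; have := hG l; rewrite fibre.
Qed.

End Example.

Theorem mainTheorem3 (R : realType) :
  [/\ inf [set lambda_min (evalmx (exF R) x) | x in exK R]%classic = 1 / 2,
      (forall eps : R, 0 < eps ->
         forall x : 'rV[R]_2, exK R x ->
           posdef (evalmx (exF R) x - (1 / 2 - eps)%:M)),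
      (forall eps : R, 0 < eps < 1 / 2 ->
         ~ exists S : 'I_2 -> 'I_2 -> 'M[{mpoly R[2]}]_2,
             (forall i j : 'I_2, sos_mx [set i] (S i j)) /\
             exF R - ((1 / 2 - eps)%:MP)%:M =
               \sum_(i < 2) (S i 0 + (4 - 'X_i ^+ 2) *: S i 1))
    & ~ sparse_putinar R 2].
Proof.
split; first exact: inf_lambda_min_exF.
- by move=> eps eps0 x _; apply: posdef_exF.
- move=> eps /andP[_ eps2] [S [hS]]; apply: exF_not_split => [|l].
    by rewrite subr_gt0.
  (* Clique [l] carries one constraint, so a constant family of multipliers suffices. *)
  by exists (S l 0), (fun=> S l 1); split=> //; rewrite big_set1.
- exact: sparse_putinar2_false.
Qed.
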